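(* Let $n \ge 0$ be an integer. Every point $p \in [0,1]\times[0,2]\times\cdots\times[0,n]$ lies in the region $R(F)$ of a unique facet $F$ of the $(n+1)$-permutahedron. Consequently the regions $R(F)$, as $F$ ranges over all facets of the $(n+1)$-permutahedron, disjointly partition the cube $[0,1]\times[0,2]\times\cdots\times[0,n]$.
   Context: Facets. Fix $n\ge 0$ and a totally ordered alphabet of $n+1$ letters, which we identify with $1<2<\cdots<n+1$ (so ''the last $k$ letters'' are $n+2-k,\dots,n+1$). A facet of the $(n+1)$-permutahedron means (combinatorially) an ordered partition $F=(G_1,\dots,G_m)$, $m\ge 1$, of the set $\{1,\dots,n+1\}$ into non-empty, internally unordered groups $G_1,\dots,G_m$. Facets of all dimensions are included: the one-group partition is the top-dimensional facet, and the partitions into singletons are the vertices. Restriction. For $1\le k\le n+1$, $F_k$ denotes the restriction of $F$ to the last $k$ letters: the ordered partition of $\{n+2-k,\dots,n+1\}$ obtained by intersecting every group of $F$ with this set and discarding empty groups, keeping the order of the groups. Region of a facet. The cube $[0,1]\times[0,2]\times\cdots\times[0,n]$ is a product of closed real intervals (a single point if $n=0$). To a facet $F$ one associates the region $$R(F)=I_1(F)\times I_2(F)\times\cdots\times I_n(F)\subseteq[0,1]\times[0,2]\times\cdots\times[0,n],$$ where $I_k(F)\subseteq[0,k]$ is determined by $F_{k+1}$ as follows. Let $\ell=n+1-k$ be the smallest letter occurring in $F_{k+1}$ (the $(k+1)$-th last letter). Let $s$ be the total number of letters of $F_{k+1}$ lying in groups strictly to the left of (i.e. before) the group containing $\ell$,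 and let $t$ be the number of letters other than $\ell$ in the group of $F_{k+1}$ containing $\ell$. Then $$I_k(F)=\begin{cases}\{s\}&\text{if } t=0,\\ (s,s+t)\ \text{(open real interval)}&\text{if } t\ge 1.\end{cases}$$ A point $p$ is said to lie in the facet $F$ if $p\in R(F)$. *)

(* Defs.v *)
From mathcomp Require Import all_boot all_order all_algebra.
From mathcomp Require Import classical_sets reals.

Set Implicit Arguments.
Unset Strict Implicit.
Unset Printing Implicit Defensive.

Import Order.TTheory GRing.Theory Num.Theory.

(* The alphabet {1 < 2 < ... < n+1} is 'I_n.+1, the ordinal i standing for the
   letter i+1.  All letter computations below are shifted accordingly. *)

Definition ordered_partition (T : finType) (A : {set T}) (F : seq {set T}) :
    bool :=
  uniq F && finset.partition [set:: F] A.

(* Since [set: 'I_n.+1] is non-empty, a facet has at least one group. *)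
Definition facet (n : nat) : Type :=
  {F : seq {set 'I_n.+1} | ordered_partition [set: 'I_n.+1] F}.

(* The last k letters n+2-k, ..., n+1, for 1 <= k <= n+1. *)
Definition last_letters (n k : nat) : {set 'I_n.+1} :=
  [set i : 'I_n.+1 | n.+1 - k <= i].

Definition restriction (n k : nat) (F : facet n) : seq {set 'I_n.+1} :=
  [seq B <- [seq G :&: last_letters n k | G <- val F] | B != finset.set0].

(* The letter n+1-k, i.e. the ordinal n-k: the smallest letter of
   [restriction k.+1 F], for 1 <= k <= n. *)
Definition letter (n k : nat) : 'I_n.+1 := sub_ord k.

Definition letter_group (n k : nat) (F : facet n) : nat :=
  find (fun G : {set 'I_n.+1} => letter n k \in G) (restriction k.+1 F).

Definition letters_before (n k : nat) (F : facet n) : nat :=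
  \sum_(G <- take (letter_group k F) (restriction k.+1 F)) #|G|.

Definition letters_beside (n k : nat) (F : facet n) : nat :=
  #|nth finset.set0 (restriction k.+1 F) (letter_group k F) :\ letter n k|.

Local Open Scope classical_set_scope.
Local Open Scope ring_scope.

Definition facet_interval (R : realType) (n k : nat) (F : facet n) : set R :=
  let s := letters_before k F in
  let t := letters_beside k F in
  if t == 0%N then [set s%:R] else [set x | s%:R < x < (s + t)%:R].

(* Points of R^n are row vectors; the k-th coordinate, 1 <= k <= n, has column
   index i : 'I_n with k = i.+1. *)
Definition cube (R : realType) (n : nat) : set 'rV[R]_n :=
  [set p | forall i : 'I_n, 0 <= p ord0 i <= i.+1%:R].
Arguments cube R n : clear implicits.

Definition region (R : realType) (n : nat) (F : facet n) : set 'rV[R]_n :=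
  [set p | forall i : 'I_n, facet_interval i.+1 F (p ord0 i)].

(* Main.v *)
(** The ordered partitions of the last k+1 letters that restrict to a given
    ordered partition H of the last k letters are obtained by inserting one new
    letter: either as a singleton in a gap of H, or into one of its groups C.
    If P is the list of groups of H before the gap (resp. before C), of total
    size s, the first insertion yields the point s and the second one the open
    interval (s, s + #|C|).  As P runs through the prefixes of H, these points
    and intervals partition [0, k].  Hence the coordinates of a point of the
    cube determine, one after the other, the restrictions of the unique facet
    containing it. *)

Require Import Defs.
From mathcomp Require Import all_boot all_order all_algebra.
From mathcomp Require Import zify.

Set Implicit Arguments.
Unset Strict Implicit.
Unset Printing Implicit Defensive.

Import Order.TTheory GRing.Theory Num.Theory.

(** * Ordered partitions, counted letter by letter *)

Section OrderedPartitions.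
Variable T : finType.
Implicit Types (A B C G : {set T}) (F H P Q : seq {set T}) (l x : T).

(** Distinctness, disjointness and covering merge into one count per letter, and counts are easily
    followed through concatenation, [map] and [filter]. *)
Lemma ordered_partitionP A F :
  reflect (set0 \notin F /\ forall x, count (fun G => x \in G) F = (x \in A))
          (ordered_partition A F).
Proof.
apply: (iffP andP) => [[uF /and3P[/eqP cF tF F0]] | [F0 cF]].
  rewrite inE in F0; split=> // x; case: (boolP (x \in A)) => [xA | xNA].
    rewrite -cF in xA.
    have -> : count (fun G => x \in G) F = count_mem (pblock [set:: F] x) F.
      apply: eq_in_count => G GF /=; apply/idP/eqP => [xG | ->].
        by rewrite (def_pblock tF _ xG) ?inE.
      by rewrite mem_pblock.
    by rewrite count_uniq_mem //; have := pblock_mem xA; rewrite inE => ->.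
  apply/eqP; rewrite -leqn0 leqNgt -has_count; apply: contra xNA.
  by case/hasP=> G GF xG; rewrite -cF; apply/bigcupP; exists G; rewrite ?inE.
have memF G : G \in F -> exists x, x \in G.
  by move=> GF; apply/set0Pn; apply: contraNneq F0 => <-.
have cntF x : count (fun G => x \in G) F <= 1 by rewrite cF leq_b1.
split.
  (* A repeated group would be counted twice at any of its letters. *)
  apply: count_mem_uniq => G; case: (boolP (G \in F)) => GF; last first.
    by rewrite (count_memPn GF).
  have [x xG] := memF _ GF.
  apply/eqP; rewrite eqn_leq -has_count has_pred1 GF andbT.
  by apply: leq_trans (cntF x); apply: sub_count => ? /= /eqP->.
apply/and3P; split; last by rewrite inE.
  apply/eqP/setP=> x; rewrite -[RHS]lt0b -cF -has_count.
  apply/bigcupP/hasP => -[G GF xG]; exists G => //; first by rewrite inE in GF.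
  by rewrite inE.
apply/trivIsetP=> B C; rewrite !inE => BF CF nBC.
rewrite -setI_eq0; apply/set0Pn=> -[x /setIP[xB xC]].
have := cntF x; rewrite leqNgt => /negP[].
(* Two distinct groups [B] and [C] sharing [x] would make its count at least 2. *)
apply: (@leq_trans (count (predU (pred1 B) (pred1 C)) F)); last first.
  by apply: sub_count => ? /= /orP[]/eqP->.
have := count_predUI (pred1 B) (pred1 C) F.
rewrite (@eq_count _ (predI _ _) pred0) ?count_pred0 ?addn0 => [->|]; last first.
  by move=> G /=; apply/andP=> -[/eqP-> BC]; rewrite BC in nBC.
by rewrite -(addn1 1) leq_add // -has_count has_pred1.
Qed.

Lemma ordered_partition_sub A F G :
  ordered_partition A F -> G \in F -> G \subset A.
Proof.
case/andP=> _ /andP[/eqP<- _] GF; apply/subsetP=> x xG.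
by apply/bigcupP; exists G; rewrite ?inE.
Qed.

Definition weight F := \sum_(G <- F) #|G|.

Lemma weight_cat P Q : weight (P ++ Q) = weight P + weight Q.
Proof. exact: big_cat. Qed.

Lemma weight_cons G F : weight (G :: F) = #|G| + weight F.
Proof. exact: big_cons. Qed.

(** Double counting of the pairs of a group and a letter in it. *)
Lemma weight_ordered_partition A F : ordered_partition A F -> weight F = #|A|.
Proof.
case/ordered_partitionP=> _ cF.
rewrite /weight; under eq_bigr do rewrite -sum1_card big_mkcond.
rewrite exchange_big -sum1_card [RHS]big_mkcond; apply: eq_bigr => x _ /=.
by rewrite -big_mkcond sum1_count cF; case: (x \in A).
Qed.

(** Stated for any list and any set of letters, so that restrictions can be iterated; [restriction]
    is an instance by unfolding. *)
Definition restrict A F := [seq B <- [seq G :&: A | G <- F] | B != set0].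

Lemma restrict_cat A P Q : restrict A (P ++ Q) = restrict A P ++ restrict A Q.
Proof. by rewrite /restrict map_cat filter_cat. Qed.

Lemma restrict_cons A G F :
  restrict A (G :: F) =
  if G :&: A == set0 then restrict A F else G :&: A :: restrict A F.
Proof. by rewrite /restrict /=; case: eqP. Qed.

Lemma restrict_id A F :
  set0 \notin F -> {in F, forall G, G \subset A} -> restrict A F = F.
Proof.
elim: F => //= G F IH; rewrite inE negb_or eq_sym => /andP[G0 F0] sF.
have /setIidPl GA := sF G (mem_head _ _).
rewrite restrict_cons GA (negPf G0) IH // => B BF.
by apply: sF; rewrite inE BF orbT.
Qed.

Lemma restrict_restrict A B F :
  A \subset B -> restrict A (restrict B F) = restrict A F.
Proof.
move=> /setIidPr BA; elim: F => //= G F IH; rewrite !restrict_cons.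
have GA : G :&: A = G :&: B :&: A by rewrite -setIA BA.
case: ifP => [/eqP GB | _]; last by rewrite restrict_cons IH -GA.
by rewrite GA GB set0I eqxx.
Qed.

Lemma ordered_partition_restrict A B F :
  A \subset B -> ordered_partition B F -> ordered_partition A (restrict A F).
Proof.
move=> /subsetP AB /ordered_partitionP[F0 cF]; apply/ordered_partitionP; split.
  by rewrite mem_filter eqxx.
move=> x; rewrite count_filter count_map.
rewrite (@eq_count _ _ (fun G => (x \in G) && (x \in A))); last first.
  move=> G /=; rewrite inE; apply: andb_idr => /andP[xG xA].
  by apply/set0Pn; exists x; rewrite inE xG.
case: (boolP (x \in A)) => xA; last first.
  by rewrite (@eq_count _ _ pred0) ?count_pred0 // => G /=; rewrite andbF.
transitivity (count (fun G => x \in G) F); last by rewrite cF AB.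
by apply: eq_count => G; rewrite andbT.
Qed.

(** * Position, deletion and insertion of one letter *)

Definition before l F := weight (take (find (fun G => l \in G) F) F).
Definition beside l F := #|nth set0 F (find (fun G => l \in G) F) :\ l|.

Section AtLetter.
Variables (l : T) (P Q : seq {set T}) (B : {set T}).
Hypotheses (lP : ~~ has (fun G => l \in G) P) (lB : l \in B).

Let find_letter : find (fun G => l \in G) (P ++ B :: Q) = size P.
Proof. by rewrite find_cat (negPf lP) /= lB addn0. Qed.

Lemma before_cat : before l (P ++ B :: Q) = weight P.
Proof. by rewrite /before find_letter take_size_cat. Qed.

Lemma beside_cat : beside l (P ++ B :: Q) = #|B :\ l|.
Proof. by rewrite /beside find_letter nth_cat ltnn subnn. Qed.

End AtLetter.

(** Since [l] has count one, all groups but [B] avoid [l], hence lie in [A] and survive restriction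
    unchanged; [B] loses [l], and disappears if it was a singleton. *)
Lemma split_letter A F l : l \notin A -> ordered_partition (l |: A) F ->
  exists P B Q, [/\ F = P ++ B :: Q, ~~ has (fun G => l \in G) P, l \in B &
    restrict A F = P ++ (if B :\ l == set0 then Q else B :\ l :: Q)].
Proof.
move=> lA FA; have [F0 /(_ l)] := ordered_partitionP _ _ FA.
have sF := ordered_partition_sub FA.
rewrite setU11 => c1.
have hF : has (fun G => l \in G) F by rewrite has_count c1.
move: F0 sF c1; case/split_find: hF => B P Q lB lP; rewrite -cats1 -catA /=.
rewrite mem_cat inE !negb_or => /and3P[P0 B0 Q0] sF.
rewrite count_cat /= lB.
move: (lP); rewrite has_count -eqn0Ngt => /eqP-> [cQ].
have lQ : ~~ has (fun G => l \in G) Q by rewrite has_count -[count _ _]add0n cQ.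
have sub H : {subset H <= P ++ B :: Q} -> ~~ has (fun G => l \in G) H ->
    {in H, forall G, G \subset A}.
  move=> sH lH G GH; have /subsetP GA := sF G (sH _ GH).
  apply/subsetP=> x xG; have := GA x xG; rewrite !inE => /orP[/eqP xl|//].
  by case/hasP: lH; exists G; rewrite -?xl.
exists P, B, Q; split=> //.
rewrite restrict_cat restrict_cons !restrict_id //.
- suff -> : B :&: A = B :\ l by [].
  have /subsetP BA : B \subset l |: A by apply: sF; rewrite mem_cat mem_head orbT.
  apply/setP=> x; rewrite !inE; have := BA x; rewrite !inE.
  case: (x \in B); rewrite ?andbF //= ?andbT => /(_ isT).
  by case: eqP => //= ->; rewrite (negPf lA).
- by apply: sub lQ => G GQ; rewrite mem_cat inE GQ !orbT.
- by apply: sub lP => G GP; rewrite mem_cat GP.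
Qed.

(** The groups up to and including that of [l] hold [before + 1 + beside] of the [#|A| + 1]
    letters. *)
Lemma before_beside_le A F l : l \notin A -> ordered_partition (l |: A) F ->
  before l F + beside l F <= #|A|.
Proof.
move=> lA FA; have [P [B [Q [eF lP lB _]]]] := split_letter lA FA.
have := weight_ordered_partition FA; rewrite cardsU1 lA.
rewrite eF before_cat // beside_cat // weight_cat weight_cons (cardsD1 l) lB.
by lia.
Qed.

(** Converse of [split_letter]: only the count of [l] changes, from 0 to 1. *)
Lemma ordered_partition_insert A P B Q l : l \notin A -> l \in B ->
  ordered_partition A (P ++ (if B :\ l == set0 then Q else B :\ l :: Q)) ->
  ordered_partition (l |: A) (P ++ B :: Q).
Proof.
move=> lA lB /ordered_partitionP[F0 cF]; apply/ordered_partitionP; split.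
  move: F0; rewrite !mem_cat !inE !negb_or => /andP[-> F0] /=; apply/andP; split.
    by rewrite eq_sym; apply/set0Pn; exists l.
  by move: F0; case: ifP => // _; rewrite inE negb_or => /andP[].
move=> x; have := cF x; rewrite !count_cat !inE /=.
have -> : count (fun G => x \in G) (if B :\ l == set0 then Q else B :\ l :: Q) =
    (x \in B :\ l) + count (fun G => x \in G) Q.
  by case: eqP => // ->; rewrite inE.
rewrite !inE; case: eqP => [-> | _] //=.
by rewrite lB (negPf lA) add0n addnCA => ->.
Qed.


(** * Points and open intervals attached to the insertions of a letter *)

Section Slots.
Variable R : realDomainType.
Implicit Types u : R.
Local Open Scope ring_scope.

(* An empty [C] stands for the gap between [P] and the rest of the partition. *)
Definition cell u P C : bool :=
  if C == set0 then u == (weight P)%:R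
  else (weight P)%:R < u < (weight P + #|C|)%:R.

Definition in_slot u l F : bool :=
  if beside l F == 0%N then u == (before l F)%:R
  else (before l F)%:R < u < (before l F + beside l F)%:R.

Lemma in_slot_cat u l P B Q : ~~ has (fun G => l \in G) P -> l \in B ->
  in_slot u l (P ++ B :: Q) = cell u P (B :\ l).
Proof.
by move=> lP lB; rewrite /in_slot before_cat // beside_cat // /cell cards_eq0.
Qed.

Lemma cell_ge u P C : cell u P C -> (weight P)%:R <= u.
Proof. by rewrite /cell; case: eqP => [_ /eqP->|_ /andP[/ltW]]. Qed.

(** The longer prefix [P'] is [P] followed by at least one more group. If [C] is non-empty, that
    group is [C], whose right end bounds [u]; otherwise [u] is the weight of [P], and the extra
    group is non-empty. With [cell_ge], this separates the cells of different prefixes. *)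
Lemma cell_lt u P C Q P' Q' :
  P ++ (if C == set0 then Q else C :: Q) = P' ++ Q' ->
  set0 \notin P' -> cell u P C -> (size P < size P')%N -> u < (weight P')%:R.
Proof.
move=> eH P'0 uP ltP.
have := congr1 (take (size P')) eH.
rewrite (take_size_cat Q' erefl) take_cat ltnNge (ltnW ltP) /= => eP'.
move: P'0 ltP; rewrite -{}eP' mem_cat negb_or size_cat weight_cat => /andP[_].
case: (size P' - size P)%N => [|k]; first by rewrite take0 addn0 ltnn.
have [C0 | C0] := eqVneq C set0.
  move: uP; rewrite /cell C0 eqxx => /eqP->.
  case: Q {eH} => [|D Q]; first by rewrite addn0 ltnn.
  rewrite /= inE negb_or eq_sym => /andP[D0 _] _.
  by rewrite ltr_nat weight_cons -card_gt0 in D0 *; lia.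
move: uP; rewrite /cell (negPf C0) => /andP[_ uC] _ _.
by apply: lt_le_trans uC _; rewrite ler_nat /= weight_cons; lia.
Qed.

Lemma in_slot_inj A u l F F' : l \notin A ->
  ordered_partition (l |: A) F -> ordered_partition (l |: A) F' ->
  restrict A F = restrict A F' -> in_slot u l F -> in_slot u l F' -> F = F'.
Proof.
move=> lA FA FA'.
have : set0 \notin restrict A F by rewrite mem_filter eqxx.
have [P [B [Q [-> lP lB eF]]]] := split_letter lA FA.
have [P' [B' [Q' [-> lP' lB' eF']]]] := split_letter lA FA'.
rewrite {}eF {}eF' => H0 eH; rewrite !in_slot_cat // => uP uP'.
have P0 : set0 \notin P by apply: contra H0 => ?; rewrite mem_cat; apply/orP; left.
have P'0 : set0 \notin P'.
  by apply: contra H0 => ?; rewrite eH mem_cat; apply/orP; left.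
have eP : size P = size P'.
  case: (ltngtP (size P) (size P')) => // [lt|gt].
    by have := cell_lt eH P'0 uP lt; rewrite ltNge (cell_ge uP').
  by have := cell_lt (esym eH) P0 uP' gt; rewrite ltNge (cell_ge uP).
move/eqP: eH; rewrite eqseq_cat // => /andP[/eqP ePP' /eqP eT].
rewrite {}ePP' {P P0 lP eP H0} in uP *.
(* With equal prefixes, it remains to exclude a gap on one side and a group on the other: [u] would
   both equal and exceed the weight of the prefix. *)
rewrite -(setD1K lB) -(setD1K lB').
move: uP uP' eT; rewrite /cell.
case: (eqVneq (B :\ l)) => [->|_]; case: (eqVneq (B' :\ l)) => [->|_].
- by move=> _ _ ->.
- by move=> /eqP->; rewrite ltxx.
- by move=> /[swap] /eqP->; rewrite ltxx.
- by move=> _ _ [-> ->].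
Qed.

(** Walk along [H]: 0 is the gap before the first group [C], values strictly between 0 and [#|C|]
    fall into [C], and larger ones are shifted by [#|C|] and sought in the tail. *)
Lemma cell_exists u H : set0 \notin H -> 0 <= u <= (weight H)%:R ->
  exists P C Q, H = P ++ (if C == set0 then Q else C :: Q) /\ cell u P C.
Proof.
rewrite /cell; elim: H u => [|C H IH] u.
  move=> _; rewrite /weight big_nil => u0.
  exists [::], set0, [::]; rewrite eqxx /weight big_nil; split=> //.
  by rewrite eq_le andbC.
rewrite inE negb_or eq_sym weight_cons => /andP[C0 H0] /andP[u0 uH].
have [-> | un0] := eqVneq u 0.
  by exists [::], set0, (C :: H); rewrite eqxx /weight big_nil.
have [uC | Cu] := ltP u #|C|%:R.
  exists [::], C, H; rewrite (negPf C0) /weight big_nil; split=> //.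
  by rewrite add0n uC lt_def un0 u0.
case: (IH (u - #|C|%:R) H0) => [|P [D [Q [-> cD]]]].
  by rewrite subr_ge0 Cu lerBlDl -natrD.
exists (C :: P), D, Q; split=> //; move: cD; rewrite weight_cons.
by case: ifP => _; rewrite ?subr_eq ?ltrBrDl ?ltrBlDl -!natrD ?addnA // addnC.
Qed.

Lemma in_slot_exists A u l H : l \notin A -> ordered_partition A H ->
  0 <= u <= #|A|%:R ->
  exists F, [/\ ordered_partition (l |: A) F, restrict A F = H & in_slot u l F].
Proof.
move=> lA HA; rewrite -(weight_ordered_partition HA) => uH.
have [H0 _] := ordered_partitionP _ _ HA.
have [P [C [Q [eH cC]]]] := cell_exists H0 uH.
have sub G : G \in H -> l \notin G.
  by move=> GH; apply: contra lA; apply/subsetP/(ordered_partition_sub HA).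
have lC : l \notin C.
  have [->|C0] := eqVneq C set0; first by rewrite inE.
  by apply: sub; rewrite eH (negPf C0) mem_cat mem_head orbT.
have lP : ~~ has (fun G => l \in G) P.
  by apply/hasPn => G GP; apply: sub; rewrite eH mem_cat GP.
have eC := setU1K lC; have lB := setU11 l C.
(* The new group [l |: C] covers both insertions: it is a singleton when [C] is empty. *)
have FA : ordered_partition (l |: A) (P ++ (l |: C) :: Q).
  by apply: ordered_partition_insert => //; rewrite eC -eH.
exists (P ++ (l |: C) :: Q); split=> //; last by rewrite in_slot_cat // eC.
rewrite restrict_cat restrict_cons.
have -> : (l |: C) :&: A = C.
  have CA : C \subset A.
    have [->|C0] := eqVneq C set0; first exact: sub0set.
    apply: (ordered_partition_sub HA).
    by rewrite eH (negPf C0) mem_cat mem_head orbT.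
  rewrite setIUl (setIidPl CA); apply/setUidPr.
  by apply/subsetP=> x; rewrite !inE => /andP[/eqP->]; rewrite (negPf lA).
rewrite -[RHS](@restrict_id A) //; last first.
  by move=> G; apply: ordered_partition_sub HA.
rewrite eH restrict_cat; congr (_ ++ _).
have [//|C0] := eqVneq C set0.
rewrite restrict_cons (setIidPl _) ?(negPf C0) //.
by apply: (ordered_partition_sub HA); rewrite eH (negPf C0) mem_cat mem_head orbT.
Qed.

End Slots.
End OrderedPartitions.

From mathcomp Require Import boolp classical_sets reals.
Local Open Scope ring_scope.

(** * Facets, their intervals and their regions *)

Section Facets.
Variables (R : realType) (n : nat).
Implicit Types (F : facet n) (u : nat -> R) (p : 'rV[R]_n).

Lemma last_letters0 : last_letters n 0 = finset.set0.
Proof. by apply/setP=> i; rewrite !inE subn0 leqNgt ltn_ord. Qed.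

Lemma last_lettersS k : (k <= n)%N ->
  last_letters n k.+1 = letter n k |: last_letters n k.
Proof.
by move=> kn; apply/setP=> i; rewrite !inE -val_eqE /=; lia.
Qed.

Lemma letter_notin k : (k <= n)%N -> letter n k \notin last_letters n k.
Proof. by rewrite inE /=; lia. Qed.

Lemma last_letters_full : last_letters n n.+1 = [set: 'I_n.+1].
Proof. by apply/setP=> i; rewrite !inE subnn. Qed.

Lemma last_letters_sub j k : (j <= k)%N -> last_letters n j \subset last_letters n k.
Proof. by move=> jk; apply/fintype.subsetP=> i; rewrite !inE; lia. Qed.

Lemma card_last_letters k : (k <= n.+1)%N -> #|last_letters n k| = k.
Proof.
elim: k => [|k IH] kn; first by rewrite last_letters0 cards0.
by rewrite last_lettersS // cardsU1 letter_notin // IH // ltnW.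
Qed.

Lemma ordered_partition_restriction k F :
  ordered_partition (last_letters n k) (restriction k F).
Proof.
apply: (@ordered_partition_restrict _ _ [set: 'I_n.+1]); last exact: valP.
exact: finset.subsetT.
Qed.

Lemma restriction_restrict j k F : (j <= k)%N ->
  restrict (last_letters n j) (restriction k F) = restriction j F.
Proof. by move=> jk; apply: restrict_restrict; apply: last_letters_sub. Qed.

Lemma restriction_full F : restriction n.+1 F = val F.
Proof.
have [F0 _] := ordered_partitionP _ _ (valP F).
by rewrite -[LHS]/(restrict _ _) last_letters_full restrict_id.
Qed.

Lemma facet_intervalP k F (x : R) :
  facet_interval k F x <-> in_slot x (letter n k) (restriction k.+1 F).
Proof.
rewrite /facet_interval /in_slot.
rewrite -/(before (letter n k) (restriction k.+1 F)).
rewrite -/(beside (letter n k) (restriction k.+1 F)).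
by case: ifP => _ //; split=> /eqP.
Qed.

Lemma letters_before_beside_le k F : (k <= n)%N ->
  (letters_before k F + letters_beside k F <= k)%N.
Proof.
move=> kn; rewrite -[leqRHS]card_last_letters ?leqW //.
apply: before_beside_le; first exact: letter_notin.
by rewrite -last_lettersS //; apply: ordered_partition_restriction.
Qed.

Lemma facet_interval_sub k F (x : R) : (k <= n)%N ->
  facet_interval k F x -> 0 <= x <= k%:R.
Proof.
move=> kn; have := letters_before_beside_le F kn.
rewrite /facet_interval; case: ifP => _ stk.
  by move=> ->; rewrite ler0n ler_nat; lia.
case/andP=> sx xt; apply/andP; split.
  by apply: le_trans (ltW sx); rewrite ler0n.
by apply: le_trans (ltW xt) _; rewrite ler_nat.
Qed.

(** Serves both to show that regions are non-empty and to identify the interval at level 0. *)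
Lemma facet_interval_nonempty k F : exists x : R, facet_interval k F x.
Proof.
rewrite /facet_interval; case: ifP => [_ | /negbT t0].
  by exists (letters_before k F)%:R.
exists (((letters_before k F)%:R + (letters_before k F + letters_beside k F)%:R) / 2).
have /midf_lt[sm mt] : (letters_before k F)%:R <
    (letters_before k F + letters_beside k F)%:R :> R by rewrite ltr_nat; lia.
by apply/andP; split.
Qed.

(** Letters are inserted from the last to the first, [letter n k] at the place dictated by [u k]. *)
Lemma facet_exists u : (forall k, 0 <= u k <= k%:R) ->
  exists F, forall k, (k <= n)%N -> facet_interval k F (u k).
Proof.
move=> uk.
have build m : (m <= n.+1)%N -> exists H, ordered_partition (last_letters n m) H /\
    forall j, (j < m)%N ->
      in_slot (u j) (letter n j) (restrict (last_letters n j.+1) H).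
  elim: m => [_|k IH kn].
    exists [::]; split=> //; apply/ordered_partitionP; split=> // x.
    by rewrite last_letters0 inE.
  have [H [HA Hu]] := IH (ltnW kn).
  have [|F [FA eF Fu]] := in_slot_exists (u := u k) (letter_notin kn) HA.
    by rewrite card_last_letters // ltnW.
  rewrite -last_lettersS // in FA.
  exists F; split=> // j; rewrite ltnS leq_eqVlt => /orP[/eqP->|jk].
    have [F0 _] := ordered_partitionP _ _ FA.
    by rewrite restrict_id // => G; apply: ordered_partition_sub FA.
  (* Earlier conditions persist, because they see [F] only through its restriction [H]. *)
  by rewrite -(restrict_restrict _ (last_letters_sub jk)) eF; apply: Hu.
have [H [HA Hu]] := build _ (leqnn _).
rewrite last_letters_full in HA.
by exists (exist _ H HA) => k kn; apply/facet_intervalP; apply: Hu.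
Qed.

(** Induction on the number of last letters: [in_slot_inj] lifts equality of restrictions by one
    letter, up to the whole alphabet. *)
Lemma facet_unique u F F' :
  (forall k, (k <= n)%N -> facet_interval k F (u k)) ->
  (forall k, (k <= n)%N -> facet_interval k F' (u k)) -> F = F'.
Proof.
move=> Fu F'u; apply: val_inj; rewrite -!restriction_full.
suff eq_restr m : (m <= n.+1)%N -> restriction m F = restriction m F'.
  exact: eq_restr.
elim: m => [_|k IH kn].
  have r0 (G : facet n) : restriction 0 G = [::].
    rewrite /restriction last_letters0; elim: (val G) => //= B s.
    by rewrite finset.setI0 eqxx.
  by rewrite !r0.
have op G := ordered_partition_restriction k.+1 G.
move: (op F) (op F'); rewrite {op} last_lettersS // => oF oF'.
apply: (in_slot_inj (letter_notin kn) oF oF').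
- by rewrite !restriction_restrict // IH // ltnW.
- exact/facet_intervalP/Fu.
- exact/facet_intervalP/F'u.
Qed.

(* The coordinate 0 at level 0 carries no information: [facet_interval 0 F] is
   always [set 0]. *)
Definition coordinate p (k : nat) : R :=
  if k is j.+1 then oapp (p ord0) 0 (insub j) else 0.

Lemma coordinateS p (i : 'I_n) : coordinate p i.+1 = p ord0 i.
Proof. by rewrite /= valK. Qed.

Lemma coordinate_cube p k : cube R n p -> 0 <= coordinate p k <= k%:R.
Proof.
move=> pc; case: k => [|k]; first by rewrite /= lexx.
by rewrite /=; case: insubP => [i _ <-|_] /=; rewrite ?pc // lexx ler0n.
Qed.

Lemma regionP p F :
  region F p <-> forall k, (k <= n)%N -> facet_interval k F (coordinate p k).
Proof.
split=> [Fp [_|k kn] | Fp i]; last by rewrite -coordinateS; apply: Fp.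
  (* The interval at level 0 is non-empty and contained in [0, 0], so it contains 0. *)
  have [x Fx] := facet_interval_nonempty 0 F.
  suff <- : x = coordinate p 0 by [].
  by apply: le_anti; rewrite andbC; apply: facet_interval_sub Fx.
by rewrite (coordinateS p (Ordinal kn)); apply: (Fp (Ordinal kn)).
Qed.

End Facets.

Theorem mainTheorem1 (R : realType) (n : nat) :
  (forall p : 'rV[R]_n, cube R n p -> exists! F : facet n, region F p) /\
  classical_sets.partition [set: facet n]%classic (@region R n) (cube R n).
Proof.
have uniqF (p : 'rV[R]_n) F F' : region F p -> region F' p -> F = F'.
  by move=> /regionP Fp /regionP F'p; apply: facet_unique Fp F'p.
have exF (p : 'rV[R]_n) : cube R n p -> exists F : facet n, region F p.
  move=> pc; have [k|F Fp] := @facet_exists R n (coordinate p).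
    exact: coordinate_cube.
  by exists F; apply/regionP.
split=> [p /exF[F Fp]|]; first by exists F; split=> // F'; apply: uniqF.
split.
- apply/seteqP; split=> p; last by case/exF=> F Fp; exists F.
  by case=> F _ Fp i; apply: facet_interval_sub (Fp i).
- by move=> F F' _ _ [p [Fp F'p]]; apply: uniqF Fp F'p.
(* A point of the region is assembled by choosing each coordinate in its interval. *)
- move=> F _.
  have ex (i : 'I_n) := cid (facet_interval_nonempty R i.+1 F).
  exists (\row_i sval (ex i)) => i.
  by rewrite mxE; apply: (svalP (ex i)).
Qed.
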